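(* All Schubert varieties $\mathcal{X}_w$ corresponding to the Coxeter elements $w$ of $S_n$ have the same tangent cone at the standard flag: if $w,w'\in S_n$ are Coxeter elements, then $\mathcal{T}_w=\mathcal{T}_{w'}$.
   Context: $\mathcal{F}$ is the variety of complete flags $V_0\subset V_1\subset\cdots\subset V_n=\mathbb{C}^n$, $\dim V_k=k$; $\varepsilon_1,\dots,\varepsilon_n$ is the standard basis, $F_0$ the standard flag $V_k=\langle\varepsilon_1,\dots,\varepsilon_k\rangle$, $B$ the group of upper-triangular matrices in $\mathrm{GL}(n,\mathbb{C})$. For $w\in S_n$, $\mathcal{X}_w$ is the closure of the $B$-orbit of the flag $V_k=\langle\varepsilon_{w(1)},\dots,\varepsilon_{w(k)}\rangle$; it contains $F_0$. Near $F_0$, flags are in bijection with lower unitriangular matrices $X=(x_{ij})$ ($V_k$ is the span of the first $k$ columns), so the $x_{ij}$, $i>j$, are local coordinates centred at $F_0$ and coordinates on $T_{F_0}\mathcal{F}$. The tangent cone $\mathcal{T}_w\subset T_{F_0}\mathcal{F}$ is the set of vectors tangent to $\mathcal{X}_w$ at $F_0$, i.e. the common zero set of the lowest-degree homogeneous parts of the polynomials in the $x_{ij}$ vanishing on $\mathcal{X}_w$ in this chart. A Coxeter element of $S_n$ is an element of length $n-1$ of the form $w=s_{i_1}s_{i_2}\cdots s_{i_{n-1}}$ in which every elementary transposition $s_i=(i\ i{+}1)$, $1\le i\le n-1$, occurs exactly once. *)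

(* Defs.v *)
From HB Require Import structures.
From mathcomp Require Import all_boot all_order all_fingroup all_algebra.
From mathcomp Require Import boolp classical_sets reals.
From mathcomp Require Import complex mpoly.

Set Implicit Arguments.
Unset Strict Implicit.
Unset Printing Implicit Defensive.

Import Order.TTheory GRing.Theory Num.Theory.

Local Open Scope ring_scope.

Lemma succ_lt_of_pred n (i : 'I_n.-1) : (i.+1 < n)%N.
Proof. by rewrite -ltn_predRL. Qed.

(* Indices are 0-based: this is s_{i+1} = (i+1 i+2) in 1-based notation. *)
Definition elem_transp n (i : 'I_n.-1) : 'S_n :=
  tperm (widen_ord (leq_pred n) i) (Ordinal (succ_lt_of_pred i)).

(* The product of permutations in the library composes from left to right, so
   this is s_{i_l} o ... o s_{i_1} as a map. The notions below are insensitive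
   to this: reversing words exchanges the two conventions. *)
Definition word_perm n (u : seq 'I_n.-1) : 'S_n :=
  (\prod_(i <- u) elem_transp i)%g.

Definition has_length n (w : 'S_n) (l : nat) : Prop :=
  (exists2 u, word_perm u = w & size u = l) /\
  (forall u, word_perm u = w -> (l <= size u)%N).

Definition is_coxeter n (w : 'S_n) : Prop :=
  has_length w n.-1 /\
  exists2 u : seq 'I_n.-1, word_perm u = w & forall i, count_mem i u = 1%N.

Section Flags.

Variable R : realType.
Local Notation C := R[i].
Variable n : nat.

Definition chain := {ffun 'I_n.+1 -> {vspace 'cV[C]_n}}.

Definition is_flag (V : chain) : bool :=
  [forall k : 'I_n.+1, \dim (V k) == k] &&
  [forall k : 'I_n.+1, forall l : 'I_n.+1, (k <= l)%N ==> (V k <= V l)%VS].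

Definition flag_variety : set chain := [set V | is_flag V].

Definition span_chain (v : 'I_n -> 'cV[C]_n) : chain :=
  [ffun k : 'I_n.+1 => <<[seq v j | j : 'I_n <- enum 'I_n & (j < k)%N]>>%VS].

Definition std_basis (i : 'I_n) : 'cV[C]_n := delta_mx i 0.

Definition perm_flag (w : 'S_n) : chain := span_chain (fun j => std_basis (w j)).

Definition col_flag (g : 'M[C]_n) : chain := span_chain (fun j => col j g).

Definition mx_act (g : 'M[C]_n) (V : chain) : chain :=
  [ffun k => (linfun (mulmx g : 'cV[C]_n -> 'cV[C]_n) @: V k)%VS].

Definition borel : set 'M[C]_n :=
  [set b | b \in unitmx /\ forall i j : 'I_n, (j < i)%N -> b i j = 0].

Definition borel_orbit (V : chain) : set chain :=
  [set mx_act b V | b in borel].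

(* Zariski topology of the flag variety: the quotient topology for the
   surjection [col_flag] from GL_n. Closed subsets of GL_n are cut out by
   polynomials in the matrix entries (denominators in det are units). *)
Definition zariski_closed (Z : set chain) : Prop :=
  (Z `<=` flag_variety)%classic /\
  exists S : set {mpoly C[n * n]},
    forall g : 'M[C]_n, g \in unitmx ->
      Z (col_flag g) <-> (forall p, S p -> p.@[fun k => mxvec g 0 k] = 0).

Definition zariski_closure (A : set chain) : set chain :=
  [set V | forall Z, zariski_closed Z -> (A `<=` Z)%classic -> Z V].

Definition schubert (w : 'S_n) : set chain :=
  zariski_closure (borel_orbit (perm_flag w)).

Definition lower_pos := {ij : 'I_n * 'I_n | (ij.2 < ij.1)%N}.

(* Points of the chart, and likewise vectors of the tangent space at the
   standard flag, are given by their coordinates x_ij, i > j. *)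
Definition coords := {ffun lower_pos -> C}.

Definition unitriangular (x : coords) : 'M[C]_n :=
  \matrix_(i, j) if insub (i, j) is Some ij then x ij else (i == j)%:R.

Definition coord_poly := {mpoly C[#|{: lower_pos}|]}.

Definition coord_eval (p : coord_poly) (x : coords) : C :=
  p.@[fun k => x (enum_val k)].

Definition lowest_degree (p : coord_poly) : nat :=
  \big[minn/msize p]_(m <- msupp p) mdeg m.

Definition lowest_part (p : coord_poly) : coord_poly :=
  pihomog mdeg (lowest_degree p) p.

Definition vanishes_on_schubert (w : 'S_n) (p : coord_poly) : Prop :=
  forall x, schubert w (col_flag (unitriangular x)) -> coord_eval p x = 0.

Definition tangent_cone (w : 'S_n) : set coords :=
  [set x | forall p, vanishes_on_schubert w p ->
             coord_eval (lowest_part p) x = 0].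

End Flags.

Arguments perm_flag R {n} w.
Arguments schubert R {n} w.
Arguments tangent_cone R {n} w.

(* Main.v *)
Require Import Defs.
From mathcomp Require Import all_boot all_order all_fingroup all_algebra.
From mathcomp Require Import boolp classical_sets reals complex mpoly.
From mathcomp Require Import zify.

(** The tangent cone of a Coxeter element does not depend on the element: it is
    the coordinate subspace L given by x_ij = 0 for all i > j + 1, spanned by
    the negative simple root vectors ([tangent_cone_coxeter]). Both inclusions
    use a word u for w in which every s_i occurs exactly once. Indices start
    at 0, and s_i exchanges i and i + 1.

    The cone lies in L ([tangent_cone_sub]). Fix a column j.
    There are two cases, according to which of s_j and s_(j+1) acts first
    ([coxeter_word_bound]). Either w maps {0, .., j} into {0, .., j + 1}, and
    then V_(j+1) is contained in the span of the first j + 2 basis vectors for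
    every flag of the Schubert variety, so x_ij itself vanishes there for
    i > j + 1; or at most one element of {0, .., j + 1} is sent beyond j, so the
    rows below j of the first j + 2 columns have rank at most 1, and the 2 x 2
    minor x_ij - x_(j+1)j x_i(j+1) vanishes. In both cases the lowest part of
    the polynomial is x_ij.

    The cone contains L ([tangent_cone_sup]). For nonzero t_i, the product X of
    the matrices 1 + t_i E_(i+1,i) along the word lies in B w B
    ([word_mx_cell]), and its subdiagonal entries are the t_i. The torus is
    contained in B, so all conjugates of X by diag(s^(a_0), s^(a_1), ..) are in
    the Schubert variety too; in the chart this multiplies x_ij by
    s^(a_i - a_j). If a is increasing, this is a curve through the standard flag
    whose velocity at s = 0 keeps exactly the entries with a_i - a_j = 1. The
    gap a_(i+1) - a_i = 1 where the wanted subdiagonal entry is nonzero, and 2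
    where it is zero, yields every vector of L as a velocity. A polynomial p
    vanishing on the curve becomes a polynomial in s whose coefficient of
    degree [lowest_degree p] is the lowest part of p at the velocity
    ([lowest_part_weighted]). *)

Set Implicit Arguments.
Unset Strict Implicit.
Unset Printing Implicit Defensive.

Import Order.TTheory GRing.Theory Num.Theory.

Local Open Scope ring_scope.

Local Notation lo i := (widen_ord (leq_pred _) i).
Local Notation hi i := (Ordinal (succ_lt_of_pred i)).

(** * Words without repeated letters *)

Section Words.
Variable n : nat.
Implicit Types (u : seq 'I_n.-1) (w : 'S_n).

Lemma word_perm_nil : word_perm [::] = 1%g :> 'S_n.
Proof. by rewrite /word_perm big_nil. Qed.

Lemma word_perm_cons i u : word_perm (i :: u) = (elem_transp i * word_perm u)%g.
Proof. by rewrite /word_perm big_cons. Qed.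

Lemma word_perm_cat u v : word_perm (u ++ v) = (word_perm u * word_perm v)%g.
Proof. by rewrite /word_perm big_cat. Qed.

(** The subgroup generated by the s_i with i different from m preserves the
    initial segment {0, .., m}, since only s_m exchanges m and m + 1. *)
Lemma word_perm_stable (m : nat) u :
  m \notin [seq val i | i <- u] ->
  forall a : 'I_n, (word_perm u a <= m)%N = (a <= m)%N.
Proof.
elim: u => [|i u IHu]; first by move=> _ a; rewrite word_perm_nil perm1.
rewrite map_cons inE negb_or => /andP[neq_mi /IHu {}IHu] a.
rewrite word_perm_cons permM IHu /elem_transp.
by move: neq_mi; case: tpermP => [->|->|//] /=; rewrite eqn_leq; lia.
Qed.

(** Cut the word at s_m. If s_(m+1) lies in the part acting first, that part
    avoids s_m and preserves {0, .., m}, while the rest avoids s_(m+1) and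
    preserves {0, .., m + 1}. Otherwise the part up to and including s_m
    preserves {0, .., m + 1} and the rest preserves {0, .., m}, so only the
    element that the first part sends to m + 1 leaves {0, .., m}. *)
Lemma coxeter_word_bound (m : nat) u : uniq u -> (m < n.-1)%N ->
  (forall i : 'I_n.-1, i \in u) ->
  (forall a : 'I_n, (a <= m)%N -> (word_perm u a <= m.+1)%N) \/
  (forall a b : 'I_n, (a <= m.+1)%N -> (b <= m.+1)%N ->
     (m < word_perm u a)%N -> (m < word_perm u b)%N -> a = b).
Proof.
move=> uniq_u lt_m full_u; pose i := Ordinal lt_m.
have memval v (j : 'I_n.-1) : (val j \in [seq val i | i <- v]) = (j \in v).
  by rewrite mem_map //; apply: val_inj.
have u_i := full_u i; case/splitPr: u_i uniq_u {full_u} => p1 p2.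
rewrite cat_uniq /= negb_or => /and4P[_ /andP[i_p1 dis] i_p2 _].
have [Sm_p1|Sm_p1] := boolP (m.+1 \in [seq val j | j <- p1]).
  left=> a le_am; rewrite word_perm_cat permM word_perm_stable.
    by rewrite (leq_trans _ (leqnSn m)) // word_perm_stable // (memval p1 i).
  rewrite map_cons inE negb_or /=; apply/andP; split; first lia.
  case/mapP: Sm_p1 => j j_p1 ->; rewrite memval.
  by apply: contra dis => j_p2; apply/hasP; exists j.
right=> a b le_a le_b; rewrite -cat_rcons word_perm_cat !permM.
rewrite !ltnNge !(@word_perm_stable m p2) ?(memval p2 i) // -!ltnNge => gt_a gt_b.
have Sm_v : m.+1 \notin [seq val j | j <- rcons p1 i].
  by rewrite map_rcons mem_rcons inE negb_or Sm_p1 andbT /= gtn_eqF.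
have := word_perm_stable Sm_v a; have := word_perm_stable Sm_v b.
rewrite le_a le_b => le_vb le_va; apply: (@perm_inj _ (word_perm (rcons p1 i))).
by apply: val_inj; apply/eqP; rewrite eqn_leq !(leq_trans _ gt_a, leq_trans _ gt_b).
Qed.

End Words.

(** * Triangular matrices and Bruhat cells *)

Section Matrices.
Variables (F : fieldType) (n : nat).
Implicit Types (g b : 'M[F]_n) (w : 'S_n).

Definition upper b := forall i j : 'I_n, (j < i)%N -> b i j = 0.

Lemma upper1 : upper 1%:M.
Proof. by move=> i j lt_ji; rewrite mxE -val_eqE gtn_eqF. Qed.

Lemma upper_mul b b' : upper b -> upper b' -> upper (b *m b').
Proof.
move=> ub ub' i j lt_ji; rewrite mxE big1 // => k _.
have [lt_ki|le_ik] := ltnP k i; first by rewrite ub ?mul0r.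
by rewrite ub' ?mulr0 // (leq_trans lt_ji).
Qed.

Lemma upper_diag_neq0 b (i : 'I_n) : upper b -> b \in unitmx -> b i i != 0.
Proof.
move=> ub; rewrite -unitmx_tr unitmxE det_trig.
  by rewrite unitfE (bigD1 i) //= mulf_eq0 mxE => /norP[].
by apply/is_trig_mxP => k l lt_kl; rewrite mxE ub.
Qed.

(** The matrix whose column j is the basis vector of index w j. *)
Definition perm_col w : 'M[F]_n := perm_mx w^-1.

Lemma perm_colE w i j : perm_col w i j = (i == w j)%:R.
Proof.
by rewrite !mxE -(inj_eq (@perm_inj _ w)) permKV.
Qed.

Definition elementary (i j : 'I_n) (c : F) : 'M[F]_n := 1%:M + c *: delta_mx i j.

Lemma mul_elementary (g : 'M_n) i j c k l :
  (g *m elementary i j c) k l = g k l + (l == j)%:R * (c * g k i).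
Proof.
rewrite mulmxDr mulmx1 -scalemxAr !mxE; congr (_ + _).
rewrite (bigD1 i) //= mxE eqxx /= big1 ?addr0.
  by case: (l == j); rewrite ?mulr1 ?mul1r ?mulr0 ?mul0r.
by move=> m /negbTE neq; rewrite mxE neq mulr0.
Qed.

Lemma elementary_mul (g : 'M_n) i j c k l :
  (elementary i j c *m g) k l = g k l + (k == i)%:R * (c * g j l).
Proof.
rewrite mulmxDl mul1mx -scalemxAl !mxE; congr (_ + _).
rewrite (bigD1 j) //= mxE eqxx andbT /= big1 ?addr0.
  by case: (k == i); rewrite ?mulr1 ?mul1r ?mul0r ?mulr0.
by move=> m /negbTE neq; rewrite mxE neq andbF mul0r.
Qed.

Lemma elementaryK i j c : i != j -> elementary i j c *m elementary i j (- c) = 1%:M.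
Proof.
move=> neq_ij; apply/matrixP=> k l; rewrite elementary_mul !mxE.
rewrite [j == i]eq_sym (negbTE neq_ij) /= mulr0 addr0 [j == l]eq_sym.
by case: (k == i); case: (l == j);
   rewrite /= ?mulr1 ?mulr0 ?mul1r ?mul0r ?addr0 ?addrNK.
Qed.

Lemma elementary_unit i j c : i != j -> elementary i j c \in unitmx.
Proof. by move=> /(elementaryK c) /mulmx1_unit[]. Qed.

Lemma upper_elementary (i j : 'I_n) c : (i < j)%N -> upper (elementary i j c).
Proof.
move=> lt_ij k l lt_lk; rewrite !mxE -[k == l]val_eqE gtn_eqF // add0r.
have [k_i|_] := eqVneq k i; last by rewrite mulr0.
have [l_j|_] := eqVneq l j; last by rewrite mulr0.
by move: lt_lk; rewrite k_i l_j ltnNge ltnW.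
Qed.

(** The double coset B w B. *)
Definition bruhat_cell w g := exists b b',
  [/\ upper b, b \in unitmx, upper b', b' \in unitmx & g = b *m perm_col w *m b'].

Lemma perm_col_elementary w i j c :
  perm_col w *m elementary i j c = elementary (w i) (w j) c *m perm_col w.
Proof.
apply/matrixP=> k l; rewrite mul_elementary elementary_mul !perm_colE.
rewrite (inj_eq perm_inj) [j == l]eq_sym.
by case: (l == j); case: (k == w i); rewrite ?mulr1 ?mul0r ?mulr0 ?mul1r.
Qed.

Lemma perm_colM v w : perm_col (v * w) = perm_col w *m perm_col v.
Proof. by rewrite /perm_col invMg perm_mxM. Qed.

(** This is the rule BwB . Bs_iB = B(w s_i)B for w i < w (i + 1). The factor
    b' (1 + t E_(i+1,i)) equals (1 + c E_(i,i+1)) s_i b'' with b'' upper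
    triangular, and the inequality is what lets 1 + c E_(i,i+1) pass to the
    left of w as an upper triangular matrix. Permutations compose from left to
    right, so w s_i reads elem_transp i * w. *)
Lemma bruhat_cell_step w g (i : 'I_n.-1) t : t != 0 -> (w (lo i) < w (hi i))%N ->
  bruhat_cell w g -> bruhat_cell (elem_transp i * w) (g *m elementary (hi i) (lo i) t).
Proof.
move=> t_neq0 lt_w [b [b' [ub Ub ub' Ub' ->]]].
have neq_i : hi i != lo i by rewrite -val_eqE /= gtn_eqF.
pose M := b' *m elementary (hi i) (lo i) t.
have Mhl : M (hi i) (lo i) = t * b' (hi i) (hi i).
  by rewrite mul_elementary eqxx mul1r (ub' _ (lo i)) ?add0r /=.
have Mhl_neq0 : M (hi i) (lo i) != 0 by rewrite Mhl mulf_neq0 ?upper_diag_neq0.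
(* Subtracting c times row i+1 from row i clears the diagonal entry of row i;
   exchanging the two rows then makes the matrix upper triangular. *)
pose c := M (lo i) (lo i) / M (hi i) (lo i).
pose s := elem_transp i.
pose b'' := perm_col s *m (elementary (lo i) (hi i) (- c) *m M).
have unitP v : perm_col v \in unitmx by apply: unitmx_perm.
have sK : perm_col s *m perm_col s = 1%:M.
  by rewrite -perm_colM /s tperm2 /perm_col invg1 perm_mx1.
have Me : elementary (lo i) (hi i) c *m (perm_col s *m b'') = M.
  rewrite /b'' (mulmxA (perm_col s)) sK mul1mx mulmxA.
  by rewrite elementaryK ?mul1mx // eq_sym.
exists (b *m elementary (w (lo i)) (w (hi i)) c), b''; split.
- exact/upper_mul/upper_elementary.
- by rewrite unitmx_mul Ub elementary_unit // (inj_eq perm_inj) eq_sym.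
- move=> k l lt_lk; rewrite /b'' /perm_col -row_permE mxE elementary_mul /s.
  rewrite /elem_transp tpermV; case: tpermP => [k_lo|k_hi|/eqP k_lo /eqP k_hi].
  + rewrite (negbTE neq_i) mul0r addr0 mul_elementary.
    have lt_l : (l < lo i)%N by rewrite -k_lo.
    by rewrite -[l == _]val_eqE ltn_eqF //= mul0r addr0 ub' //= ltnW.
  + have le_l : (l <= lo i)%N by rewrite k_hi in lt_lk.
    have [->|neq_l] := eqVneq l (lo i).
      by rewrite eqxx mul1r /c mulNr divfK ?subrr.
    have lt_l : (l < lo i)%N by rewrite ltn_neqAle neq_l.
    rewrite !mul_elementary (negbTE neq_l) !mul0r !addr0.
    by rewrite !ub' ?mulr0 ?addr0 //= ltnW.
  + rewrite (negbTE k_lo) mul0r addr0 mul_elementary ub' // add0r.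
    have [l_lo|_] := eqVneq l (lo i); last by rewrite mul0r.
    rewrite ub' ?mulr0 //; rewrite l_lo /= in lt_lk; rewrite ltn_neqAle lt_lk andbT.
    by rewrite eq_sym; apply: contra k_hi => /eqP k_hi; apply/eqP/val_inj.
- by rewrite /b'' !unitmx_mul unitP elementary_unit 1?eq_sym //= Ub' elementary_unit.
- rewrite -mulmxA -/M -Me perm_colM -/s.
  by rewrite -!mulmxA [in LHS](mulmxA (perm_col w)) perm_col_elementary !mulmxA.
Qed.

Definition word_mx (t : 'I_n.-1 -> F) (u : seq 'I_n.-1) : 'M[F]_n :=
  foldr (fun i g => g *m elementary (hi i) (lo i) (t i)) 1%:M u.

(** When the letter i is treated, the letters already multiplied differ from i,
    so their product preserves {0, .., i}; this gives the inequality required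
    by [bruhat_cell_step]. *)
Lemma word_mx_cell t u : (forall i, t i != 0) -> uniq u ->
  bruhat_cell (word_perm u) (word_mx t u).
Proof.
move=> t_neq0; elim: u => [_|i u IHu /= /andP[i_u uniq_u]].
  exists 1%:M, 1%:M; rewrite word_perm_nil /perm_col invg1 perm_mx1 !mulmx1 unitmx1.
  by split=> //; apply: upper1.
rewrite word_perm_cons; apply: bruhat_cell_step (IHu uniq_u) => //.
have i_u' : val i \notin [seq val j | j <- u].
  by rewrite mem_map //; apply: val_inj.
apply: (@leq_ltn_trans i); first by rewrite (word_perm_stable i_u').
by rewrite ltnNge (word_perm_stable i_u') /= ltnn.
Qed.

Lemma word_mx_lower t u (k l : 'I_n) : (k <= l)%N -> word_mx t u k l = (k == l)%:R.
Proof.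
elim: u k l => [|i u IHu] k l le_kl /=; first by rewrite mxE.
rewrite mul_elementary IHu //; have [l_lo|_] := eqVneq l (lo i);
  last by rewrite mul0r addr0.
have le_k : (k <= i)%N by rewrite l_lo in le_kl.
have neq_k : (k == hi i) = false by rewrite -val_eqE /= ltn_eqF.
by rewrite (IHu k (hi i)) ?neq_k ?mulr0 ?addr0 // (leq_trans le_k (leqnSn i)).
Qed.

Lemma word_mx_sub t u i : uniq u -> i \in u -> word_mx t u (hi i) (lo i) = t i.
Proof.
have aux v j : word_mx t v (hi j) (lo j) = (count_mem j v)%:R * t j.
  elim: v => [|k v IHv] /=; first by rewrite mxE -val_eqE /= gtn_eqF // mul0r.
  rewrite mul_elementary IHv natrD mulrDl addrC; congr (_ + _).
  rewrite -[lo j == _]val_eqE /= eq_sym.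
  have [<-|neq_kj] := eqVneq k j; last by rewrite val_eqE (negbTE neq_kj) !mul0r.
  by rewrite eqxx word_mx_lower // eqxx mulr1.
by move=> uniq_u u_i; rewrite aux count_uniq_mem // u_i mul1r.
Qed.
End Matrices.

(** * Lowest homogeneous parts *)

Section LowestPart.
Variables (R : realType) (n : nat).
Local Notation C := R[i].
Implicit Types (p q r : coord_poly R n) (x y : coords R n).

Lemma lowest_degree_le p m : m \in msupp p -> (lowest_degree p <= mdeg m)%N.
Proof.
rewrite /lowest_degree; elim: (msupp p : seq _) (msize p) => // m' s IHs x.
rewrite inE big_cons => /predU1P[->|/IHs le_m]; first exact: geq_minl.
exact: leq_trans (geq_minr _ _) (le_m x).
Qed.

Lemma lowest_degree_ge p d : (d <= msize p)%N ->
  (forall m, m \in msupp p -> (d <= mdeg m)%N) -> (d <= lowest_degree p)%N.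
Proof.
move=> d_size d_supp; rewrite /lowest_degree big_seq.
by elim/big_ind: _ => // a b; rewrite leq_min => -> ->.
Qed.

Lemma lowest_part_add p q r d e : (d < e)%N -> q != 0 ->
  q \is d.-homog -> r \is e.-homog -> p = q + r -> lowest_part p = q.
Proof.
move=> lt_de q_neq0 q_hom r_hom ->.
have m_q := mlead_supp q_neq0.
have q_deg := dhomog_mf q_hom; have r_deg := dhomog_mf r_hom.
have deg_m := q_deg _ m_q.
have m_qr : mlead q \in msupp (q + r).
  rewrite mcoeff_msupp mcoeffD [r@__]memN_msupp_eq0 ?addr0 -?mcoeff_msupp //.
  by apply/negP => /r_deg; rewrite deg_m => d_e; rewrite d_e ltnn in lt_de.
have low_d : lowest_degree (q + r) = d.
  apply/eqP; rewrite eqn_leq -{1}deg_m lowest_degree_le //=.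
  apply: lowest_degree_ge => [|m]; first by rewrite -deg_m ltnW ?msize_mdeg_lt.
  move/msuppD_le; rewrite mem_cat => /orP[/q_deg->//|].
  by move/r_deg->; apply: ltnW.
rewrite /lowest_part low_d pihomogD pihomog_dE // (pihomog_ne0 _ r_hom) ?addr0 //.
by rewrite gtn_eqF.
Qed.

Lemma poly_eq0_nonzero (P : {poly C}) : (forall s, s != 0 -> P.[s] = 0) -> P = 0.
Proof.
move=> P0; apply/eqP; apply: contraT => P_neq0.
(* The characteristic is 0, so 1, .., size P are too many roots. *)
pose rs := [seq i%:R : C | i <- iota 1 (size P)].
have := @max_poly_roots _ P rs P_neq0; rewrite size_map size_iota ltnn; apply.
  apply/allP => z /mapP [j]; rewrite mem_iota => /andP[j_gt0 _] {z}->.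
  by rewrite rootE P0 // pnatr_eq0 -lt0n.
rewrite map_inj_uniq ?iota_uniq // => i j /eqP.
by rewrite eqr_nat => /eqP.
Qed.

(** Substituting s^(e k) y_k for the coordinates sends the monomial of exponent
    m to a multiple of s^(wt m), with wt m the sum of the e k * m k. As all
    weights are positive, wt m >= deg m >= d for d the lowest degree of p, so
    the coefficient of s^d only sees the monomials of degree d in the
    coordinates of weight 1. All other monomials of the lowest part vanish
    at x. *)
Lemma lowest_part_weighted p x y (e : lower_pos n -> nat) :
  (forall k, 0 < e k)%N ->
  (forall k, x k = if e k == 1%N then y k else 0) ->
  (forall s, s != 0 -> coord_eval p [ffun k => s ^+ e k * y k] = 0) ->
  coord_eval (lowest_part p) x = 0.
Proof.
move=> e_gt0 xE p0; pose N := #|{: lower_pos n}|.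
pose wt (m : 'X_{1..N}) := (\sum_k e (enum_val k) * m k)%N.
pose mon (z : coords R n) (m : 'X_{1..N}) := \prod_k z (enum_val k) ^+ m k.
pose P := \sum_(m <- msupp p) (p@_m * mon y m) *: 'X^(wt m).
have P0 : P = 0.
  apply: poly_eq0_nonzero => s s_neq0; rewrite -[RHS](p0 s s_neq0).
  rewrite /coord_eval mevalE horner_sum; apply: eq_bigr => m _.
  rewrite hornerZ hornerXn -mulrA; congr (_ * _).
  rewrite /wt expr_sum -big_split /=; apply: eq_bigr => k _.
  by rewrite ffunE exprMn exprM mulrC.
pose d := lowest_degree p.
have := congr1 (fun Q : {poly C} => Q`_d) P0; rewrite coef0 => <-.
rewrite /P coef_sum /coord_eval /lowest_part pihomogE raddf_sum /=.
rewrite big_mkcond /= big_seq [RHS]big_seq; apply: eq_bigr => m m_p.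
have deg_wt : (mdeg m <= wt m)%N.
  by rewrite mdegE; apply: leq_sum => k _; rewrite leq_pmull.
rewrite coefZ coefXn mevalZ mevalX -/d.
case: (eqVneq (mdeg m) d) => [deg_m|deg_m]; last first.
  rewrite ltn_eqF ?mulr0 // (leq_trans _ deg_wt) // ltn_neqAle eq_sym deg_m.
  exact: lowest_degree_le.
rewrite -mulrA; congr (_ * _).
(* If some coordinate of weight greater than 1 occurs in m, then wt m > d and
   the monomial also vanishes at x; otherwise wt m = d and x, y agree on m. *)
have [/forallP flat|] := boolP [forall k, (m k == 0%N) || (e (enum_val k) == 1%N)].
  have -> : wt m = d.
    rewrite -deg_m mdegE; apply: eq_bigr => k _.
    by case/orP: (flat k) => /eqP ->; rewrite ?muln0 ?mul1n.
  rewrite eqxx mulr1; apply: eq_bigr => k _; rewrite xE.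
  by case/orP: (flat k) => /eqP ->.
case/forallPn => k; rewrite negb_or => /andP[mk_neq0 ek_neq1].
rewrite (bigD1 k) //= xE (negbTE ek_neq1) expr0n (negbTE mk_neq0) mul0r.
rewrite ltn_eqF ?mulr0 // -deg_m mdegE /wt (bigD1 k) //= [X in (_ < X)%N](bigD1 k) //=.
rewrite -addSn leq_add //; last by apply: leq_sum => j _; rewrite leq_pmull.
by rewrite ltn_Pmull ?lt0n // ltn_neqAle eq_sym ek_neq1 e_gt0.
Qed.

End LowestPart.

(** * Flags of matrices and Schubert varieties *)

Section Flags.
Variables (R : realType) (n : nat).
Local Notation C := R[i].
Implicit Types (g b : 'M[C]_n) (w : 'S_n) (V : chain R n).

Lemma mem_span_chain (v : 'I_n -> 'cV[C]_n) (k : 'I_n.+1) (y : 'cV[C]_n) :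
  y \in span_chain v k <->
  exists2 c : 'cV[C]_n, (forall j : 'I_n, (k <= j)%N -> c j 0 = 0)
                      & y = \sum_j c j 0 *: v j.
Proof.
rewrite ffunE span_def big_map big_filter big_enum_cond /=.
rewrite (eq_bigl (fun j : 'I_n => j < k)%N) //.
split=> [/memv_sumP [vs vs_in ->]|[c c0 ->]].
  have /fin_all_exists [c cP] (j : 'I_n) : exists c, (j < k)%N -> vs j = c *: v j.
    have [lt_jk|] := boolP (j < k)%N; last by exists 0.
    by have /vlineP [c ->] := vs_in j lt_jk; exists c.
  exists (\col_j (if (j < k)%N then c j else 0)) => [j le_kj|].
    by rewrite mxE ltnNge le_kj.
  rewrite big_mkcond; apply: eq_bigr => j _; rewrite mxE.
  by case: ifP => [/cP|]; rewrite ?scale0r.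
rewrite (bigID (fun j : 'I_n => j < k)%N) /= [X in _ + X]big1 ?addr0.
  by apply: memv_sumr => j _; rewrite memvZ ?memv_line.
by move=> j; rewrite -leqNgt => /c0 ->; rewrite scale0r.
Qed.

Lemma mulmx_sum_col g (c : 'cV[C]_n) : g *m c = \sum_j c j 0 *: col j g.
Proof.
apply/colP=> a; rewrite summxE mxE; apply: eq_bigr => j _.
by rewrite !mxE mulrC.
Qed.

Lemma mem_col_flag g (k : 'I_n.+1) (y : 'cV[C]_n) :
  y \in col_flag g k <->
  exists2 c : 'cV[C]_n, (forall j : 'I_n, (k <= j)%N -> c j 0 = 0) & y = g *m c.
Proof.
by rewrite mem_span_chain; split=> -[c c0 ->]; exists c; rewrite ?mulmx_sum_col.
Qed.

Lemma mx_act_col b g : mx_act b (col_flag g) = col_flag (b *m g).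
Proof.
apply/ffunP => k; rewrite !ffunE limg_span -map_comp; congr (<<_>>%VS).
apply: eq_map => j /=; rewrite lfunE /=.
by rewrite !colE mulmxA.
Qed.

Lemma perm_flagE w : perm_flag R w = col_flag (perm_col C w).
Proof.
congr span_chain; apply: boolp.funext => j; apply/colP=> a.
by rewrite [RHS]mxE perm_colE mxE eqxx andbT.
Qed.

(** The columns span the whole space, and there are only n of them. *)
Lemma col_free g : g \in unitmx -> free [seq col j g | j <- enum 'I_n].
Proof.
move=> Ug; set X := map _ _.
have sizeX : size X = n by rewrite size_map size_enum_ord.
suff spanX : (fullv <= <<X>>)%VS.
  have : basis_of fullv X.
    by rewrite basisEdim spanX dimvf sizeX /dim /= muln1.
  by case/andP.
apply/subvP=> y _; rewrite span_def big_map -[y](mulKVmx Ug).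
rewrite mulmx_sum_col big_enum; apply: memv_sumr => j _.
by rewrite memvZ ?memv_line.
Qed.

Lemma col_flag_is_flag g : g \in unitmx -> is_flag (col_flag g).
Proof.
move=> Ug; apply/andP; split; last first.
  apply/forallP => k; apply/forallP => l; apply/implyP => le_kl.
  apply/subvP => y /mem_col_flag [c c0 ->]; apply/mem_col_flag.
  by exists c => // j le_lj; rewrite c0 // (leq_trans le_kl).
apply/forallP=> k; rewrite ffunE.
pose a (j : 'I_n) := (j < k)%N.
have := col_free Ug.
rewrite -(perm_free (X := [seq col j g | j <- filter a (enum 'I_n)] ++
  [seq col j g | j <- filter (predC a) (enum 'I_n)])); last first.
  by rewrite -map_cat perm_map // perm_filterC.
move/catl_free/eqnP => ->.
rewrite size_map size_filter -[X in _ == X]/(nat_of_ord k).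
rewrite -(count_map (@nat_of_ord n) (fun j => j < k)%N) val_enum_ord.
have le_kn : (k <= n)%N by rewrite -ltnS.
have -> : iota 0 n = iota 0 k ++ iota k (n - k) by rewrite -iotaD subnKC.
have below : count (fun j => j < k)%N (iota 0 k) = k.
  rewrite -[RHS](size_iota 0) -[RHS]count_predT; apply: eq_in_count => j.
  by rewrite mem_iota add0n /= => ->.
have above : count (fun j => j < k)%N (iota k (n - k)) = 0%N.
  apply/eqP; rewrite -leqn0 leqNgt -has_count; apply/hasPn => j.
  by rewrite mem_iota -leqNgt => /andP[].
by rewrite count_cat below above addn0.
Qed.

(** Only one inclusion has to be checked: both sides are flags, hence have the
    same dimensions. *)
Lemma col_flag_upper g b : g \in unitmx -> b \in unitmx -> upper b ->
  col_flag (g *m b) = col_flag g.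
Proof.
move=> Ug Ub ub; apply/ffunP=> k; apply/eqP; rewrite eqEdim.
have Ugb : g *m b \in unitmx by rewrite unitmx_mul Ug.
have /andP[/forallP /(_ k) /eqP-> _] := col_flag_is_flag Ugb.
have /andP[/forallP /(_ k) /eqP-> _] := col_flag_is_flag Ug.
rewrite leqnn andbT; apply/subvP => y /mem_col_flag [c c0 ->].
apply/mem_col_flag; exists (b *m c); last by rewrite mulmxA.
move=> j le_kj; rewrite mxE big1 // => l _.
have [lt_lj|le_jl] := ltnP l j; first by rewrite ub ?mul0r.
by rewrite c0 ?mulr0 // (leq_trans le_kj).
Qed.

Lemma orbit_schubert w V : borel_orbit (perm_flag R w) V -> schubert R w V.
Proof. by move=> orbV Z _; apply. Qed.

Lemma cell_schubert w g : bruhat_cell w g -> schubert R w (col_flag g).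
Proof.
case=> b [b' [ub Ub ub' Ub' ->]]; apply: orbit_schubert.
exists b => //; rewrite perm_flagE mx_act_col [RHS]col_flag_upper //.
by rewrite unitmx_mul Ub unitmx_perm.
Qed.

(** If Q is expressed by polynomial equations in the entries of a matrix of the
    flag, it defines a closed set; so it passes from the Borel orbit to its
    closure. *)
Lemma schubert_sub w (Q : chain R n -> Prop) (S : set {mpoly C[n * n]}) :
  (forall g, g \in unitmx -> Q (col_flag g) <->
    (forall p, S p -> p.@[fun k => mxvec g 0 k] = 0)) ->
  (forall b, upper b -> b \in unitmx -> Q (col_flag (b *m perm_col C w))) ->
  forall V, schubert R w V -> Q V.
Proof.
move=> QS Qorb V /(_ [set V | is_flag V /\ Q V]%classic) [].
- split; first by move=> V' [].
  exists S => g Ug; rewrite -QS //=; split=> [[]//|Qg].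
  by split=> //; apply: col_flag_is_flag.
- move=> _ [b [Ub ub] <-]; rewrite perm_flagE mx_act_col /=; split; last exact: Qorb.
  by apply: col_flag_is_flag; rewrite unitmx_mul Ub unitmx_perm.
- by [].
Qed.

End Flags.

(** * Equations of Schubert varieties *)

Section Minors.
Variables (R : realType) (n : nat).
Local Notation C := R[i].
Implicit Types (g b : 'M[C]_n) (w : 'S_n) (V : chain R n).

Lemma col_mem_flag g (j : 'I_n) (k : 'I_n.+1) : (j < k)%N -> col j g \in col_flag g k.
Proof.
move=> lt_jk; apply/mem_col_flag; exists (delta_mx j 0); last by rewrite colE.
by move=> i le_ki; rewrite mxE -val_eqE gtn_eqF // (leq_trans lt_jk).
Qed.

Lemma mul_perm_col g w i j : (g *m perm_col C w) i j = g i (w j).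
Proof. by rewrite /perm_col -col_permE mxE. Qed.

(** The conclusion says that V_k is contained in the span of the first l basis
    vectors, a closed condition invariant under the Borel group. *)
Lemma schubert_entry_eq0 w (k l : nat) g : (k <= n)%N ->
  (forall j : 'I_n, (j < k)%N -> (w j < l)%N) ->
  schubert R w (col_flag g) ->
  forall i j : 'I_n, (l <= i)%N -> (j < k)%N -> g i j = 0.
Proof.
rewrite -ltnS => lt_kn w_kl gw; pose k' := Ordinal lt_kn.
pose Q V := forall y, y \in V k' -> forall i : 'I_n, (l <= i)%N -> y i 0 = 0.
pose zero g := forall i j : 'I_n, (l <= i)%N -> (j < k)%N -> g i j = 0.
have QE g' : Q (col_flag g') <-> zero g'.
  split=> [Qg i j le_li lt_jk|zero_g y /mem_col_flag [c c0 ->] i le_li].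
    by have := Qg _ (@col_mem_flag g' j k' lt_jk) i le_li; rewrite mxE.
  rewrite mxE big1 // => j _; have [lt_jk|le_kj] := ltnP j k.
    by rewrite zero_g ?mul0r.
  by rewrite c0 ?mulr0.
pose S := [set p : {mpoly C[n * n]} | exists i j : 'I_n,
  [/\ (l <= i)%N, (j < k)%N & p = 'X_(mxvec_index i j)]]%classic.
apply/QE; apply: (@schubert_sub R n w Q S) gw => [g' _|b ub _].
  rewrite QE; split=> [zero_g p [i [j [le_li lt_jk ->]]]|S0 i j le_li lt_jk].
    by rewrite mevalXU mxvecE zero_g.
  have := S0 'X_(mxvec_index i j); rewrite mevalXU mxvecE; apply.
  by exists i, j.
apply/QE => i j le_li lt_jk; rewrite mul_perm_col ub //.
exact: leq_trans (w_kl j lt_jk) le_li.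
Qed.

(** The conclusion says that V_k has rank at most 1 modulo the first l basis
    vectors. In the proof this is put on pairs of vectors of V_k, so that it visibly depends
    on the flag only; by bilinearity it amounts to the 2 x 2 minors in the rows
    from l on of the first k columns of any matrix of the flag. On b w with b
    upper triangular, such a minor has a zero column unless both of its columns
    are sent by w to l or beyond. *)
Lemma schubert_minor_eq0 w (k l : nat) g : (k <= n)%N ->
  (forall j j' : 'I_n, (j < k)%N -> (j' < k)%N ->
     (l <= w j)%N -> (l <= w j')%N -> j = j') ->
  schubert R w (col_flag g) ->
  forall i i' j j' : 'I_n, (l <= i)%N -> (l <= i')%N -> (j < k)%N -> (j' < k)%N ->
    g i j * g i' j' = g i' j * g i j'.
Proof.
rewrite -ltnS => lt_kn w_kl gw; pose k' := Ordinal lt_kn.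
pose Q V := forall y z, y \in V k' -> z \in V k' ->
  forall i i' : 'I_n, (l <= i)%N -> (l <= i')%N ->
    y i 0 * z i' 0 = y i' 0 * z i 0.
pose zero g := forall i i' j j' : 'I_n, (l <= i)%N -> (l <= i')%N ->
  (j < k)%N -> (j' < k)%N -> g i j * g i' j' = g i' j * g i j'.
have QE g' : Q (col_flag g') <-> zero g'.
  split=> [Qg i i' j j' le_li le_li' lt_jk lt_jk'|zero_g y z].
    have := Qg _ _ (@col_mem_flag g' j k' lt_jk) (@col_mem_flag g' j' k' lt_jk').
    by move=> /(_ i i' le_li le_li'); rewrite !mxE.
  move=> /mem_col_flag [c c0 ->] /mem_col_flag [d d0 ->] i i' le_li le_li'.
  rewrite !mxE !big_distrlr /=; apply: eq_bigr => j _; apply: eq_bigr => j' _.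
  have [lt_jk|le_kj] := ltnP j k; last by rewrite c0 // !(mulr0, mul0r).
  have [lt_jk'|le_kj'] := ltnP j' k; last by rewrite d0 // !(mulr0, mul0r).
  by rewrite mulrACA zero_g // mulrACA.
pose S := [set p : {mpoly C[n * n]} | exists i i' j j' : 'I_n,
  [/\ (l <= i)%N, (l <= i')%N, (j < k)%N, (j' < k)%N
    & p = 'X_(mxvec_index i j) * 'X_(mxvec_index i' j')
        - 'X_(mxvec_index i' j) * 'X_(mxvec_index i j')]]%classic.
apply/QE; apply: (@schubert_sub R n w Q S) gw => [g' _|b ub _].
  have evalE i i' j j' : ('X_(mxvec_index i j) * 'X_(mxvec_index i' j')
      - 'X_(mxvec_index i' j) * 'X_(mxvec_index i j')).@[fun m => mxvec g' 0 m]
      = g' i j * g' i' j' - g' i' j * g' i j'.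
    by rewrite mevalB !mevalM !mevalXU !mxvecE.
  rewrite QE; split=> [zero_g p|S0 i i' j j' le_li le_li' lt_jk lt_jk'].
    case=> i [i' [j [j' [le_li le_li' lt_jk lt_jk' ->]]]].
    by rewrite evalE zero_g ?subrr.
  by apply/eqP; rewrite -subr_eq0 -evalE S0 //; exists i, i', j, j'.
apply/QE => i i' j j' le_li le_li' lt_jk lt_jk'; rewrite !mul_perm_col.
have [->|neq_jj'] := eqVneq j j'; first by rewrite mulrC.
have [lt_wl|le_lw] := ltnP (w j) l.
  by rewrite (ub i) ?(ub i' (w j)) ?mul0r // (leq_trans lt_wl).
have [lt_wl'|le_lw'] := ltnP (w j') l.
  by rewrite (ub i' (w j')) ?(ub i (w j')) ?mulr0 // (leq_trans lt_wl').
by rewrite (w_kl j j') ?eqxx // in neq_jj'.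
Qed.

End Minors.

(** * The tangent cone of a Coxeter element *)

Section Cone.
Variables (R : realType) (n : nat).
Local Notation C := R[i].
Implicit Types (w : 'S_n) (x : coords R n).

Lemma unitriangular_lower x (k : lower_pos n) :
  unitriangular x (val k).1 (val k).2 = x k.
Proof. by rewrite mxE -surjective_pairing valK. Qed.

Lemma unitriangular_upper x (i j : 'I_n) :
  (i <= j)%N -> unitriangular x i j = (i == j)%:R.
Proof. by move=> le_ij; rewrite mxE insubF //= ltnNge le_ij. Qed.

Lemma coord_evalX (k : lower_pos n) x : coord_eval 'X_(enum_rank k) x = x k.
Proof. by rewrite /coord_eval mevalXU enum_rankK. Qed.

Lemma dhomog_var (k : 'I_#|{: lower_pos n}|) : ('X_k : coord_poly R n) \is 1.-homog.
Proof. by rewrite dhomogX /= mdeg1. Qed.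

Lemma var_neq0 (k : 'I_#|{: lower_pos n}|) : ('X_k : coord_poly R n) != 0.
Proof. by rewrite -msupp_eq0 msuppX. Qed.

(** A word using every letter exactly once provides, for each position off the
    subdiagonal, an equation of the Schubert variety whose lowest part is the
    coordinate at this position. *)
Lemma tangent_cone_sub u x (k : lower_pos n) :
  uniq u -> (forall i : 'I_n.-1, i \in u) ->
  tangent_cone R (word_perm u) x -> (val k).1 != (val k).2.+1 :> nat -> x k = 0.
Proof.
move=> uniq_u full_u x_cone neq_k.
have [q [q_van q_low]] : exists q : coord_poly R n,
    vanishes_on_schubert (word_perm u) q /\ lowest_part q = 'X_(enum_rank k).
  case: k neq_k => [[i j] /= lt_ji] neq_ij.
  have lt_Sji : (j.+1 < i)%N by rewrite ltn_neqAle eq_sym neq_ij.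
  have lt_Sj : (j.+1 < n)%N := ltn_trans lt_Sji (ltn_ord i).
  have lt_j : (j < n.-1)%N by rewrite ltn_predRL.
  pose k : lower_pos n := exist _ (i, j) lt_ji.
  pose j1 := Ordinal lt_Sj.
  have [bound|bound] := coxeter_word_bound uniq_u lt_j full_u.
    exists 'X_(enum_rank k); split=> [z z_w|].
      rewrite coord_evalX -unitriangular_lower.
      exact: (schubert_entry_eq0 (k := j.+1) (l := j.+2) _ _ z_w).
    apply: (@lowest_part_add _ _ _ _ 0 1 2); rewrite ?addr0 ?rpred0 //.
    - exact: var_neq0.
    - exact: dhomog_var.
  pose lower (ij : 'I_n * 'I_n) := (ij.2 < ij.1)%N.
  pose k1 : lower_pos n := exist lower (j1, j) (ltnSn j).
  pose k2 : lower_pos n := exist lower (i, j1) lt_Sji.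
  exists ('X_(enum_rank k) - 'X_(enum_rank k1) * 'X_(enum_rank k2)).
  split=> [z z_w|].
    rewrite /coord_eval mevalB mevalM -!/(coord_eval _ _) !coord_evalX.
    rewrite -!unitriangular_lower /=.
    have := @schubert_minor_eq0 R n (word_perm u) j.+2 j.+1 _ lt_Sj bound
      z_w j1 i j j1 (leqnn _) (ltnW lt_Sji) (ltnW (ltnSn _)) (ltnSn _).
    by rewrite (unitriangular_upper z (leqnn j1)) eqxx mulr1 => ->; rewrite subrr.
  apply: (@lowest_part_add _ _ _ _
    (- ('X_(enum_rank k1) * 'X_(enum_rank k2))) 1 2) => //.
  - exact: var_neq0.
  - exact: dhomog_var.
  - by rewrite rpredN; apply: (dhomogM (dhomog_var _) (dhomog_var _)).
by rewrite -coord_evalX -q_low x_cone.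
Qed.

Lemma bruhat_cell_conj_diag w (g : 'M[C]_n) (d d' : 'rV[C]_n) :
  (forall i, d 0 i * d' 0 i = 1) -> bruhat_cell w g ->
  bruhat_cell w (diag_mx d *m g *m diag_mx d').
Proof.
move=> dd' [b [b' [ub Ub ub' Ub' ->]]].
have up_diag (f : 'rV[C]_n) : upper (diag_mx f).
  by move=> i j lt_ji; rewrite mxE -val_eqE gtn_eqF.
have [Ud Ud'] : (diag_mx d \in unitmx) /\ (diag_mx d' \in unitmx).
  apply: mulmx1_unit; apply/matrixP=> i j; rewrite mul_diag_mx !mxE.
  by case: eqP => [->|]; rewrite ?dd' ?mulr0.
exists (diag_mx d *m b), (b' *m diag_mx d'); split.
- exact: upper_mul.
- by rewrite unitmx_mul Ud.
- exact: upper_mul.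
- by rewrite unitmx_mul Ub'.
- by rewrite !mulmxA.
Qed.

(** Every such x is the velocity at s = 0 of a curve
    diag(s^a) X diag(s^(-a)) inside the Schubert variety. *)
Lemma tangent_cone_sup u x : uniq u -> (forall i : 'I_n.-1, i \in u) ->
  (forall k : lower_pos n, (val k).1 != (val k).2.+1 :> nat -> x k = 0) ->
  tangent_cone R (word_perm u) x.
Proof.
move=> uniq_u full_u x0 p p_van.
pose sub (i : 'I_n.-1) := unitriangular x (hi i) (lo i).
(* The cell needs nonzero parameters; where x has a zero entry, any value will
   do, because the gap 2 makes this entry of the curve quadratic in s. *)
pose t i := if sub i == 0 then 1 else sub i.
have t_neq0 i : t i != 0 by rewrite /t; case: ifPn; rewrite ?oner_neq0.
pose gap (m : nat) := if insub m is Some i then (sub i == 0).+1 else 1%N.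
have gap_gt0 m : (0 < gap m)%N by rewrite /gap; case: insub.
pose a (i : nat) := (\sum_(0 <= m < i) gap m)%N.
pose e (k : lower_pos n) := (\sum_((val k).2 <= m < (val k).1) gap m)%N.
have aE (k : lower_pos n) : a (val k).1 = (a (val k).2 + e k)%N.
  by rewrite /a (big_cat_nat (n := (val k).2)) //= ltnW // (valP k).
pose X := word_mx t u.
pose y : coords R n := [ffun k => X (val k).1 (val k).2].
apply: (@lowest_part_weighted R n p x y e) => [k|k|s s_neq0].
- case: k => -[i j] /= lt_ji; rewrite /e /= big_ltn //=.
  by rewrite (leq_trans (gap_gt0 j)) ?leq_addr.
- have [eq_k|neq_k] := eqVneq ((val k).1 : nat) (val k).2.+1; last first.
    rewrite x0 // ifN //; move: (valP k) neq_k; rewrite /e.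
    case: (val k) => i j /= lt_ji neq_ij.
    have lt_Sji : (j.+1 < i)%N by rewrite ltn_neqAle eq_sym neq_ij.
    rewrite big_ltn // big_ltn //= gtn_eqF // addnA ltn_addr //.
    by rewrite -[1%N]/(0 + 1)%N -addn1 leq_add.
  have lt_k : ((val k).2 < n.-1)%N by rewrite ltn_predRL -eq_k ltn_ord.
  pose i := Ordinal lt_k.
  have [hiE loE] : hi i = (val k).1 /\ lo i = (val k).2 by split; apply: val_inj.
  have subE : sub i = x k by rewrite /sub hiE loE unitriangular_lower.
  have yE : y k = t i by rewrite ffunE -hiE -loE word_mx_sub.
  have -> : e k = (sub i == 0).+1.
    by rewrite /e eq_k big_nat1 /gap -[(val k).2 : nat]/(val i) valK.
  by rewrite yE /t subE; have [->|] := eqVneq (x k) 0.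
- apply: p_van; apply: cell_schubert.
  pose d := \row_(i < n) s ^+ a i : 'rV[C]_n.
  pose d' := \row_(i < n) s ^- a i : 'rV[C]_n.
  suff -> : unitriangular [ffun k => s ^+ e k * y k] = diag_mx d *m X *m diag_mx d'.
    apply: bruhat_cell_conj_diag (word_mx_cell t_neq0 uniq_u) => i.
    by rewrite !mxE divff // expf_neq0.
  apply/matrixP=> i j; rewrite mul_mx_diag mul_diag_mx !mxE -/X.
  have [le_ij|lt_ji] := leqP i j.
    rewrite insubF ?ltnNge ?le_ij //= word_mx_lower //.
    by case: eqP => [->|_]; rewrite ?mulr1 ?divff ?expf_neq0 // !(mulr0, mul0r).
  rewrite insubT !ffunE /= -/X; set k := Sub _ _.
  have -> : a i = (a j + e k)%N by rewrite -(aE k).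
  by rewrite exprD mulrAC [s ^+ a j * _]mulrC mulfK ?expf_neq0.
Qed.

Lemma tangent_cone_coxeter w : is_coxeter w ->
  tangent_cone R w = [set x | forall k : lower_pos n,
    (val k).1 != (val k).2.+1 :> nat -> x k = 0]%classic.
Proof.
case=> _ [u <- count_u].
have full_u i : i \in u by rewrite -has_pred1 has_count count_u.
have uniq_u : uniq u by apply: count_mem_uniq => i; rewrite count_u full_u.
apply/seteqP; split=> x x_P; last exact: tangent_cone_sup.
by move=> k; apply: tangent_cone_sub x_P.
Qed.

End Cone.

Theorem corollary3p8 (R : realType) (n : nat) (w w' : 'S_n) :
  is_coxeter w -> is_coxeter w' ->
  tangent_cone R w = tangent_cone R w'.
Proof. by move=> w_cox w'_cox; rewrite !tangent_cone_coxeter. Qed.
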